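(* Let $l\ge 1$ be an integer, $a>0$, $k_0>0$, and let $\epsilon_{\mathrm b}\in\mathbb{C}\setminus(-\infty,0]$ with $\operatorname{Im}\epsilon_{\mathrm b}\ge 0$, $k_{\mathrm b}=k_0\sqrt{\epsilon_{\mathrm b}}$. Let $a_{2l}$, $b_{2l}$, $c_{2l}$ be as defined in the context. For $t\in\mathbb{C}$ let $$C_{\mathrm{s},2l}(t)=-\frac{2\pi(2l+1)}{|k_{\mathrm b}|^2}\,a_{2l}|t|^2,\qquad C_{\mathrm{abs},2l}(t)=\frac{2\pi(2l+1)}{|k_{\mathrm b}|^2}\left(a_{2l}|t|^2+2\operatorname{Re}\{b_{2l}t\}+c_{2l}\right)$$ be the electric multipole scattering and absorption cross sections. Then the maximum of $C_{\mathrm{s},2l}(t)$ over all $t\in\mathbb{C}$ satisfying the constraint $C_{\mathrm{abs},2l}(t)\ge 0$ is attained at $t=\beta b_{2l}^*$, where $$\beta=-\frac{1}{a_{2l}}+\sqrt{\frac{1}{a_{2l}^2}-\frac{c_{2l}}{a_{2l}|b_{2l}|^2}},$$ and the maximal value (the optimal scattering cross section of the rotationally invariant sphere) is $$C_{\mathrm{s},2l}^{\mathrm{opt}}=\frac{2\pi(2l+1)}{|k_{\mathrm b}|^2}\,(-a_{2l})\,|b_{2l}|^2\beta^2 .$$ In particular, for a lossless background ($\operatorname{Im}k_{\mathrm b}=0$) one has $a_{2l}=-1$, $b_{2l}=-1/2$, $c_{2l}=0$, the optimal solution is $t=-1$, and $C_{\mathrm{s},2l}^{\mathrm{opt}}=2\pi(2l+1)/k_{\mathrm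 b}^2$.
   Context: Square roots are principal (branch cut along the negative real axis); $z^*$ is the complex conjugate. $\mathrm{j}_l$ is the spherical Bessel function and $\mathrm{h}_l^{(1)}$ the spherical Hankel function of the first kind; the Riccati-Bessel functions are $\psi_l(z)=z\,\mathrm{j}_l(z)$, $\xi_l(z)=z\,\mathrm{h}^{(1)}_l(z)$, and a prime denotes the derivative with respect to the argument. Define $$a_{2l}=-\operatorname{Im}\left\{\frac{k_{\mathrm b}^*}{\operatorname{Re} k_{\mathrm b}}\,\xi_l'(k_{\mathrm b}a)\,\xi_l(k_{\mathrm b}a)^*\right\},$$ $$b_{2l}=\frac{1}{2\mathrm i}\left(-\frac{k_{\mathrm b}^*}{\operatorname{Re} k_{\mathrm b}}\,\xi_l'(k_{\mathrm b}a)\,\psi_l(k_{\mathrm b}a)^*+\frac{k_{\mathrm b}}{\operatorname{Re} k_{\mathrm b}}\,\psi_l'(k_{\mathrm b}a)^*\,\xi_l(k_{\mathrm b}a)\right),$$ $$c_{2l}=-\operatorname{Im}\left\{\frac{k_{\mathrm b}^*}{\operatorname{Re} k_{\mathrm b}}\,\psi_l'(k_{\mathrm b}a)\,\psi_l(k_{\mathrm b}a)^*\right\}.$$ Here $a_{2l}$ and $c_{2l}$ are real, $b_{2l}$ is complex, and $a_{2l}<0$ (since the scattered power is non-negative in a passive medium). Physical meaning: a rotationally invariant sphere of radius $a$ in a passive background of relative permittivity $\epsilon_{\mathrm b}$ (time convention $\mathrm e^{-\mathrm i\omega t}$, vacuum wavenumber $k_0$) scatters the electric multipole of order $l$ with a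 complex scattering coefficient $t=t_{2l}$ independent of the azimuthal index; with plane wave incidence, the cross sections are the scattered and absorbed powers in that multipole divided by the plane wave intensity at the origin. The constraint $C_{\mathrm{abs},2l}\ge 0$ expresses that the absorption is non-negative.
   Formalization: The general optimality claim and value are stated under the condition b_{2l} ≠ 0, since β divides by |b_{2l}|² and b_{2l} can vanish for some lossy backgrounds, where β is undefined; the lossless part needs no such condition. *)

(* Defs.v *)
From Stdlib Require Export Reals.
From Coquelicot Require Export Coquelicot.
Open Scope R_scope.

Definition Cexp (z : C) : C :=
  (exp (Re z) * cos (Im z), exp (Re z) * sin (Im z)).

Definition Csin (z : C) : C := ((Cexp (Ci * z) - Cexp (- (Ci * z))) / (2 * Ci))%C.
Definition Ccos (z : C) : C := ((Cexp (Ci * z) + Cexp (- (Ci * z))) / 2)%C.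

(** Principal square root, with non-negative real part; the cut is the negative
    real axis, where the value has non-negative imaginary part. *)
Definition Csqrt (z : C) : C :=
  (sqrt ((Cmod z + Re z) / 2),
   (if Rle_dec 0 (Im z) then 1 else -1) * sqrt ((Cmod z - Re z) / 2)).

(** Rayleigh's formulas (DLMF 10.49.13 and 10.49.14), [C_derive] being the
    complex derivative:
      j_l(z) =   z^l (- 1/z d/dz)^l (sin z / z),
      y_l(z) = - z^l (- 1/z d/dz)^l (cos z / z).
    The value at [z = 0] is meaningless; only [z <> 0] is used. *)
Definition rayleigh (l : nat) (f : C -> C) : C -> C :=
  Nat.iter l (fun g z => (- (C_derive g z / z))%C) f.

Definition sph_j (l : nat) (z : C) : C :=
  (z ^ l * rayleigh l (fun w => (Csin w / w)%C) z)%C.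
Definition sph_y (l : nat) (z : C) : C :=
  (- (z ^ l * rayleigh l (fun w => (Ccos w / w)%C) z))%C.
Definition sph_h1 (l : nat) (z : C) : C := (sph_j l z + Ci * sph_y l z)%C.

Definition psi (l : nat) (z : C) : C := (z * sph_j l z)%C.
Definition xi (l : nat) (z : C) : C := (z * sph_h1 l z)%C.
Definition psi' (l : nat) (z : C) : C := C_derive (psi l) z.
Definition xi' (l : nat) (z : C) : C := C_derive (xi l) z.

(** Below, [l] is the electric multipole order, [a] the radius of the sphere and
    [k] the background wavenumber; the digit 2 in [a2], [b2], [c2] is the index
    of the electric multipoles. *)

Definition a2 (l : nat) (a : R) (k : C) : R :=
  - Im (Cconj k / Re k * xi' l (k * a) * Cconj (xi l (k * a)))%C.

Definition b2 (l : nat) (a : R) (k : C) : C :=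
  (1 / (2 * Ci) *
     (- (Cconj k / Re k * xi' l (k * a) * Cconj (psi l (k * a)))
      + k / Re k * Cconj (psi' l (k * a)) * xi l (k * a)))%C.

Definition c2 (l : nat) (a : R) (k : C) : R :=
  - Im (Cconj k / Re k * psi' l (k * a) * Cconj (psi l (k * a)))%C.

Definition Cs (l : nat) (a : R) (k t : C) : R :=
  - (2 * PI * (2 * INR l + 1) / Cmod k ^ 2) * a2 l a k * Cmod t ^ 2.

Definition Cabs (l : nat) (a : R) (k t : C) : R :=
  2 * PI * (2 * INR l + 1) / Cmod k ^ 2 *
    (a2 l a k * Cmod t ^ 2 + 2 * Re (b2 l a k * t)%C + c2 l a k).

Definition is_optimal (l : nat) (a : R) (k t : C) : Prop :=
  0 <= Cabs l a k t /\
  forall s : C, 0 <= Cabs l a k s -> Cs l a k s <= Cs l a k t.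

(** Meaningful only when [a2 l a k] and [b2 l a k] are nonzero. The radicand is
    then (|b|^2 - a c) / (a^2 |b|^2), which is positive because the Wronskian
    [psi * xi' - psi' * xi = Ci] makes |b|^2 - a c positive. *)
Definition beta (l : nat) (a : R) (k : C) : R :=
  - (1 / a2 l a k)
  + sqrt (1 / a2 l a k ^ 2 - c2 l a k / (a2 l a k * Cmod (b2 l a k) ^ 2)).

(* Main.v *)
From Stdlib Require Import Lra.
Require Import Defs.

(** Rayleigh's formulas give the recurrences f_{l+1} = (2l+1)/z f_l - f_{l-1} and
    f_l' = f_{l-1} - (l/z) f_l for psi_l and xi_l. From these, with z = k a, the two
    fluxes P_l = Im (k^* xi_{l-1} xi_l^* ) and G_l = Im (k xi_{l-1} xi_l^* ) satisfy
    P_{l+1} = G_l and G_{l+1} >= P_l because Im (k^2) >= 0; both equal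
    Re k |e^{iz}|^2 > 0 for l = 0, and - Re k a_{2l} >= P_l, so a_{2l} < 0 without any
    asymptotics at infinity. Further a_{2l}, b_{2l}, c_{2l} are values of one Hermitian
    form H(u, v) of signature (1,1) at xi and psi, and its determinant gives
    |b|^2 - a c = |k|^2 |W|^2 / (4 (Re k)^2) >= 0 with W the Wronskian. As
    Re (b t) <= |b| |t|, the constraint bounds |t| by the positive root
    beta |b| of a x^2 + 2 |b| x + c, which t = beta b^* attains. *)

(** * Rules for complex derivatives *)

(* [C_AbsRing] as a module over itself, since the product and composition rules are
   stated for it; [C_NormedModule], which [C_derive] refers to, is another instance on
   [C], with the same norm but another uniform structure. *)
Definition is_Cderive (f : C -> C) (z l : C) : Prop :=
  is_derive (K := C_AbsRing) (V := AbsRing_NormedModule C_AbsRing) f z l.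

Lemma C_derive_eq f z l : is_Cderive f z l -> C_derive f z = l.
Proof.
  intros [_ H]. apply is_C_derive_unique. split.
  - apply is_linear_scal_l.
  - exact H.
Qed.

(** Reduces differentiability to an explicit second-order estimate, which is how the inverse and the
    exponential are handled. *)
Lemma is_Cderive_quadratic f z l (M : R) (d : posreal) :
  (forall h, Cmod h < d -> Cmod (f (z + h) - f z - h * l)%C <= M * Cmod h ^ 2) ->
  is_Cderive f z l.
Proof.
  intros H. split.
  - apply is_linear_scal_l.
  - intros x Hx eps.
    assert (x = z) as -> by
      (symmetry; exact (@is_filter_lim_locally_unique C_AbsRing (AbsRing_NormedModule C_AbsRing) z x Hx)).
    (* [M] may be zero or negative; [M'] can be divided by. *)
    pose (M' := Rmax M 1).
    assert (HM' : 0 < M') by (unfold M'; generalize (Rmax_r M 1); lra).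
    assert (Hd : 0 < Rmin d (eps / M')).
    { apply Rmin_pos; [apply cond_pos|]. apply Rdiv_lt_0_compat; auto. apply cond_pos. }
    exists (mkposreal _ Hd). intros y Hy.
    change (Cmod (y - z)%C < Rmin d (eps / M')) in Hy.
    change (Cmod (f y - f z - (y - z) * l)%C <= eps * Cmod (y - z)%C).
    assert (E : forall w : C, (z + (w - z))%C = w) by (intros w; ring).
    specialize (H (y - z)%C). rewrite E in H.
    eapply Rle_trans. { apply H. generalize (Rmin_l d (eps / M')); lra. }
    assert (0 <= Cmod (y - z)%C) by apply Cmod_ge_0.
    assert (Cmod (y - z)%C < eps / M') by (generalize (Rmin_r d (eps / M')); lra).
    apply Rle_trans with (M' * Cmod (y - z)%C * Cmod (y - z)%C).
    { assert (M <= M') by apply Rmax_l. nra. }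
    apply Rmult_le_compat_r; [assumption|].
    apply Rmult_lt_compat_l with (r := M') in H1; [|lra].
    replace (M' * (eps / M')) with (pos eps) in H1 by (field; lra). lra.
Qed.

Lemma is_Cderive_ext_loc f g z l (d : posreal) :
  (forall w, Cmod (w - z)%C < d -> f w = g w) -> is_Cderive f z l -> is_Cderive g z l.
Proof.
  intros H. apply is_derive_ext_loc. exists d. intros w Hw. apply H. exact Hw.
Qed.

Lemma is_Cderive_ext f g z l :
  (forall w, f w = g w) -> is_Cderive f z l -> is_Cderive g z l.
Proof. intros H. apply is_Cderive_ext_loc with (d := mkposreal 1 Rlt_0_1). auto. Qed.

Lemma is_Cderive_eq f z l l' : is_Cderive f z l -> l = l' -> is_Cderive f z l'.
Proof. now intros H <-. Qed.

Lemma is_Cderive_const c z : is_Cderive (fun _ => c) z 0.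
Proof. exact (@is_derive_const C_AbsRing (AbsRing_NormedModule C_AbsRing) c z). Qed.

Lemma is_Cderive_id z : is_Cderive (fun w => w) z 1.
Proof. exact (@is_derive_id C_AbsRing z). Qed.

Lemma is_Cderive_plus f g z df dg :
  is_Cderive f z df -> is_Cderive g z dg ->
  is_Cderive (fun w => f w + g w)%C z (df + dg)%C.
Proof. exact (@is_derive_plus C_AbsRing (AbsRing_NormedModule C_AbsRing) f g z df dg). Qed.

Lemma is_Cderive_mult f g z df dg :
  is_Cderive f z df -> is_Cderive g z dg ->
  is_Cderive (fun w => f w * g w)%C z (df * g z + f z * dg)%C.
Proof.
  intros Hf Hg. exact (@is_derive_mult C_AbsRing f g z df dg Hf Hg Cmult_comm).
Qed.

Lemma is_Cderive_comp f g z df dg :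
  is_Cderive f (g z) df -> is_Cderive g z dg ->
  is_Cderive (fun w => f (g w)) z (dg * df)%C.
Proof. exact (@is_derive_comp C_AbsRing (AbsRing_NormedModule C_AbsRing) f g z df dg). Qed.

Lemma is_Cderive_scal c f z df :
  is_Cderive f z df -> is_Cderive (fun w => c * f w)%C z (c * df)%C.
Proof.
  intros H. eapply is_Cderive_eq.
  - apply is_Cderive_mult; [apply is_Cderive_const | exact H].
  - cbv beta; ring.
Qed.

Lemma C_ball_nonzero (z w : C) : z <> 0 -> Cmod (w - z)%C < Cmod z / 2 ->
  Cmod z / 2 <= Cmod w /\ w <> 0.
Proof.
  intros Hz H. apply Cmod_gt_0 in Hz.
  assert (Cmod z <= Cmod w + Cmod (w - z)%C).
  { replace z with (w + - (w - z))%C at 1 by ring.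
    eapply Rle_trans; [apply Cmod_triangle|]. rewrite Cmod_opp. lra. }
  split; [lra|]. apply Cmod_gt_0. lra.
Qed.

(** The remainder is exactly h^2 / (z^2 (z + h)), and |z + h| >= |z| / 2 on the chosen ball, whence
    the constant 2 / |z|^3. *)
Lemma is_Cderive_inv (z : C) : z <> 0 -> is_Cderive Cinv z (- / (z * z))%C.
Proof.
  intros Hz. pose proof (proj1 (Cmod_gt_0 z) Hz) as Hm.
  assert (Hd : 0 < Cmod z / 2) by lra.
  apply is_Cderive_quadratic with (M := 2 / Cmod z ^ 3) (d := mkposreal _ Hd).
  intros h Hh. simpl in Hh.
  destruct (C_ball_nonzero z (z + h) Hz) as [Hle Hnz].
  { now replace (z + h - z)%C with h by ring. }
  replace (/ (z + h) - / z - h * - / (z * z))%C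
    with (h ^ 2 / (z ^ 2 * (z + h)))%C by (field; auto).
  rewrite Cmod_div, Cmod_mult, !Cmod_pow by (apply Cmult_neq_0; [apply Cpow_nz|]; auto).
  unfold Rdiv. rewrite (Rmult_comm (2 * _)). apply Rmult_le_compat_l; [apply pow2_ge_0|].
  replace (2 * / Cmod z ^ 3) with (/ (Cmod z ^ 2 * (Cmod z / 2))) by (field; lra).
  apply Rinv_le_contravar.
  - apply Rmult_lt_0_compat; [apply pow_lt|]; lra.
  - apply Rmult_le_compat_l; [apply pow2_ge_0|lra].
Qed.

(** * Complex exponential, sine and cosine *)

Lemma C_eq (z w : C) : Re z = Re w -> Im z = Im w -> z = w.
Proof. destruct z, w; simpl; now intros -> ->. Qed.

Lemma Cexp_plus z w : Cexp (z + w) = (Cexp z * Cexp w)%C.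
Proof.
  destruct z, w. apply C_eq; simpl; rewrite exp_plus; [rewrite cos_plus | rewrite sin_plus]; ring.
Qed.

Lemma cos_sub_1_bound y : Rabs (cos y - 1) <= Rabs y.
Proof.
  destruct (MVT_abs cos (fun x => - sin x) 0 y) as [c [Hc _]].
  - intros c _. apply derivable_pt_lim_cos.
  - rewrite cos_0, Rminus_0_r, Rabs_Ropp in Hc. rewrite Hc.
    rewrite <- (Rmult_1_l (Rabs y)) at 2.
    apply Rmult_le_compat_r; [apply Rabs_pos|]. apply Rabs_le, SIN_bound.
Qed.

Lemma sin_sub_id_bound y : Rabs (sin y - y) <= Rabs y ^ 2.
Proof.
  destruct (MVT_abs (fun x => sin x - x) (fun x => cos x - 1) 0 y) as [c [Hc Hcy]].
  - intros c _. apply derivable_pt_lim_minus;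
      [apply derivable_pt_lim_sin | apply derivable_pt_lim_id].
  - rewrite sin_0, !Rminus_0_r in Hc. rewrite Hc. simpl.
    rewrite Rmult_1_r. apply Rmult_le_compat_r; [apply Rabs_pos|].
    eapply Rle_trans; [apply cos_sub_1_bound|].
    revert Hcy. unfold Rmin, Rmax, Rabs.
    destruct (Rle_dec 0 y), (Rcase_abs c), (Rcase_abs y); lra.
Qed.

Lemma cos_sub_1_quadratic y : Rabs (cos y - 1) <= Rabs y ^ 2.
Proof.
  destruct (MVT_abs cos (fun x => - sin x) 0 y) as [c [Hc Hcy]].
  - intros c _. apply derivable_pt_lim_cos.
  - rewrite cos_0, Rminus_0_r, Rabs_Ropp in Hc. rewrite Hc. simpl.
    rewrite Rmult_1_r. apply Rmult_le_compat_r; [apply Rabs_pos|].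
    destruct (MVT_abs sin cos 0 c) as [e [He _]].
    { intros e _. apply derivable_pt_lim_sin. }
    rewrite sin_0, !Rminus_0_r in He. rewrite He.
    apply Rle_trans with (Rabs c).
    { rewrite <- (Rmult_1_l (Rabs c)) at 2.
      apply Rmult_le_compat_r; [apply Rabs_pos|]. apply Rabs_le, COS_bound. }
    revert Hcy. unfold Rmin, Rmax, Rabs.
    destruct (Rle_dec 0 y), (Rcase_abs c), (Rcase_abs y); lra.
Qed.

(** Both sides come from 1 + u <= exp u: at u = x the difference is non-negative, and at u = -x one
    gets exp x <= 1 / (1 - x), so it is at most x^2 / (1 - x) <= 2 x^2. *)
Lemma exp_sub_affine_bound x : Rabs x <= 1 / 2 -> Rabs (exp x - 1 - x) <= 2 * Rabs x ^ 2.
Proof.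
  intros H. rewrite RPow_abs, (Rabs_pos_eq (x ^ 2)) by apply pow2_ge_0.
  assert (H1 : -(1/2) <= x <= 1/2) by (now apply Rabs_le_between).
  pose proof (exp_ineq1_le x). pose proof (exp_ineq1_le (- x)).
  pose proof (exp_pos x).
  assert (exp x * exp (- x) = 1) by (rewrite <- exp_plus, Rplus_opp_r; apply exp_0).
  rewrite Rabs_pos_eq by lra.
  assert (exp x * (1 - x) <= 1) by nra.
  assert ((exp x - 1 - x - 2 * x ^ 2) * (1 - x) <= 0); nra.
Qed.

Lemma Cexp_near_0 h : Cmod h < 1 / 2 -> Cmod (Cexp h - 1 - h)%C <= 8 * Cmod h ^ 2.
Proof.
  intros H. destruct h as [x y]. 
  assert (Hx : Rabs x <= Cmod (x, y)).
  { eapply Rle_trans; [|apply Rmax_Cmod]. apply Rmax_l. }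
  assert (Hy : Rabs y <= Cmod (x, y)).
  { eapply Rle_trans; [|apply Rmax_Cmod]. apply Rmax_r. }
  set (m := Cmod (x, y)) in *.
  assert (He : Rabs (exp x - 1 - x) <= 2 * Rabs x ^ 2) by (apply exp_sub_affine_bound; lra).
  pose proof (cos_sub_1_quadratic y) as Hc. pose proof (sin_sub_id_bound y) as Hs.
  pose proof (Rabs_pos x). pose proof (Rabs_pos y). 
  assert (Hx2 : Rabs x ^ 2 <= m ^ 2) by (apply pow_incr; lra).
  assert (Hy2 : Rabs y ^ 2 <= m ^ 2) by (apply pow_incr; lra).
  assert (He1 : Rabs (exp x - 1) <= 2 * m).
  { replace (exp x - 1) with ((exp x - 1 - x) + x) by ring.
    eapply Rle_trans; [apply Rabs_triang|]. nra. }
  assert (He2 : Rabs (exp x) <= 2).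
  { replace (exp x) with (1 + (exp x - 1)) by ring.
    eapply Rle_trans; [apply Rabs_triang|]. rewrite Rabs_R1. lra. }
  assert (HC : forall z : C, Cmod z <= Rabs (Re z) + Rabs (Im z)).
  { intros [u v]. replace (u, v) with (u + Ci * v)%C by (apply C_eq; simpl; ring).
    eapply Rle_trans; [apply Cmod_triangle|].
    rewrite Cmod_mult, Cmod_Ci, !Cmod_R. simpl.
    replace (u + (0 * v - 1 * 0)) with u by ring.
    replace (0 + (0 * 0 + 1 * v)) with v by ring. lra. }
  eapply Rle_trans; [apply HC|]. simpl.
  (* Each part is split so that every term is of second order; with |exp x| <= 2 and |exp x - 1| <=
     2 m, each part is at most 4 m^2. *)
  replace (exp x * cos y + - (1) + - x)
    with (exp x * (cos y - 1) + (exp x - 1 - x)) by ring.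
  replace (exp x * sin y + - 0 + - y)
    with (exp x * (sin y - y) + (exp x - 1) * y) by ring.
  assert (Rabs (exp x * (cos y - 1) + (exp x - 1 - x)) <= 4 * m ^ 2).
  { eapply Rle_trans; [apply Rabs_triang|]. rewrite Rabs_mult.
    pose proof (Rabs_pos (exp x)). pose proof (Rabs_pos (cos y - 1)). nra. }
  assert (Rabs (exp x * (sin y - y) + (exp x - 1) * y) <= 4 * m ^ 2).
  { eapply Rle_trans; [apply Rabs_triang|]. rewrite !Rabs_mult.
    pose proof (Rabs_pos (exp x)). pose proof (Rabs_pos (exp x - 1)).
    pose proof (Rabs_pos (sin y - y)). nra. }
  simpl in *. lra.
Qed.

Lemma is_Cderive_Cexp z : is_Cderive Cexp z (Cexp z).
Proof.
  assert (Hd : 0 < 1 / 2) by lra.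
  apply is_Cderive_quadratic with (M := Cmod (Cexp z) * 8) (d := mkposreal _ Hd).
  intros h Hh. rewrite Cexp_plus.
  replace (Cexp z * Cexp h - Cexp z - h * Cexp z)%C
    with (Cexp z * (Cexp h - 1 - h))%C by ring.
  rewrite Cmod_mult, Rmult_assoc. apply Rmult_le_compat_l; [apply Cmod_ge_0|].
  now apply Cexp_near_0.
Qed.

Lemma is_Cderive_Cexp_lin c z :
  is_Cderive (fun w => Cexp (c * w)) z (c * Cexp (c * z))%C.
Proof.
  apply is_Cderive_comp; [apply is_Cderive_Cexp|].
  eapply is_Cderive_eq; [apply is_Cderive_scal, is_Cderive_id | ring].
Qed.

Lemma Ci_sqr : (Ci * Ci = - (1))%C.
Proof. apply C_eq; simpl; ring. Qed.

Lemma Csin_exp z : Csin z = (/ (2 * Ci) * (Cexp (Ci * z) + - (1) * Cexp ((- Ci) * z)))%C.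
Proof.
  unfold Csin, Cdiv. replace (- (Ci * z))%C with ((- Ci) * z)%C by ring. ring.
Qed.

Lemma Ccos_exp z : Ccos z = (/ 2 * (Cexp (Ci * z) + Cexp ((- Ci) * z)))%C.
Proof.
  unfold Ccos, Cdiv. replace (- (Ci * z))%C with ((- Ci) * z)%C by ring. ring.
Qed.

Lemma is_Cderive_Csin z : is_Cderive Csin z (Ccos z).
Proof.
  apply (is_Cderive_ext _ _ _ _ (fun w => eq_sym (Csin_exp w))).
  eapply is_Cderive_eq.
  - apply is_Cderive_scal, is_Cderive_plus; [|apply is_Cderive_scal];
      apply is_Cderive_Cexp_lin.
  - rewrite Ccos_exp. field. apply Ci_nz.
Qed.

Lemma is_Cderive_Ccos z : is_Cderive Ccos z (- Csin z)%C.
Proof.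
  apply (is_Cderive_ext _ _ _ _ (fun w => eq_sym (Ccos_exp w))).
  eapply is_Cderive_eq.
  - apply is_Cderive_scal, is_Cderive_plus; apply is_Cderive_Cexp_lin.
  - rewrite Csin_exp.
    replace (/ (2 * Ci))%C with (/ 2 * - Ci)%C; [ring|].
    apply C_eq; simpl; field.
Qed.

(** * Riccati recurrence and Rayleigh's formula *)

(* The pair (f_l, f_{l-1}); the recurrence is started at l = 0, so [p] contains f_0 and
   f_{-1} = f_0'. *)
Fixpoint riccati (p : C * C) (z : C) (l : nat) : C * C :=
  match l with
  | O => p
  | S n => let q := riccati p z n in
           (RtoC (2 * INR n + 1) / z * fst q - snd q, fst q)%C
  end.

Definition rb (f g : C -> C) (l : nat) (z : C) : C := fst (riccati (f z, g z) z l).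
Definition rb_prev (f g : C -> C) (l : nat) (z : C) : C := snd (riccati (f z, g z) z l).

Lemma rb_S f g l z :
  rb f g (S l) z = (RtoC (2 * INR l + 1) * / z * rb f g l z + - (1) * rb_prev f g l z)%C.
Proof. unfold rb, rb_prev. cbn [riccati fst snd]. unfold Cdiv. ring. Qed.

(** The hypotheses f' = g, g' = -f cover both (sin, cos) and (cos, -sin). The two derivatives are
    proved together: the second one at l + 1 is the first one at l, rewritten by the recurrence. *)
Lemma is_Cderive_rb f g :
  (forall z, is_Cderive f z (g z)) -> (forall z, is_Cderive g z (- f z)%C) ->
  forall l (z : C), z <> 0 ->
  is_Cderive (rb f g l) z (rb_prev f g l z - RtoC (INR l) / z * rb f g l z)%C /\
  is_Cderive (rb_prev f g l) z (- rb f g l z + RtoC (INR l) / z * rb_prev f g l z)%C.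
Proof.
  intros Hf Hg l z Hz. induction l as [|l [IHx IHy]].
  - unfold rb, rb_prev; simpl. split; eapply is_Cderive_eq.
    + apply Hf.
    + field; auto.
    + apply Hg.
    + field; auto.
  - rewrite S_INR. split.
    + apply (is_Cderive_ext _ _ _ _ (fun w => eq_sym (rb_S f g l w))).
      eapply is_Cderive_eq.
      * apply is_Cderive_plus; [|apply is_Cderive_scal, IHy].
        apply is_Cderive_mult; [|apply IHx].
        apply is_Cderive_scal, is_Cderive_inv, Hz.
      * rewrite rb_S. change (rb_prev f g (S l) z) with (rb f g l z).
        rewrite !RtoC_plus, !RtoC_mult. field. auto.
    + change (rb_prev f g (S l)) with (rb f g l).
      eapply is_Cderive_eq; [apply IHx|].
      rewrite rb_S, !RtoC_plus, !RtoC_mult. field. auto.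
Qed.

Lemma is_Cderive_pow n z :
  is_Cderive (fun w => (w ^ S n)%C) z (RtoC (INR (S n)) * z ^ n)%C.
Proof.
  induction n as [|n IH].
  - apply (is_Cderive_ext (fun w => w)); [intros w; simpl; ring|].
    eapply is_Cderive_eq; [apply is_Cderive_id | simpl; ring].
  - apply (is_Cderive_ext (fun w => (w * w ^ S n)%C)); [reflexivity|].
    eapply is_Cderive_eq.
    + apply is_Cderive_mult; [apply is_Cderive_id | apply IH].
    + rewrite (S_INR (S n)), RtoC_plus. simpl Cpow. ring.
Qed.

Lemma is_Cderive_ext_nonzero f g (z l : C) :
  z <> 0 -> (forall w : C, w <> 0 -> f w = g w) -> is_Cderive f z l -> is_Cderive g z l.
Proof.
  intros Hz H.
  assert (Hd : 0 < Cmod z / 2) by (apply Cmod_gt_0 in Hz; lra).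
  apply is_Cderive_ext_loc with (d := mkposreal _ Hd).
  intros w Hw. now apply H, (C_ball_nonzero z).
Qed.

(** One application of -1/z d/dz sends f_l / z^(l+1) to f_{l+1} / z^(l+2): the terms l/z and (l+1)/z
    from the two factors add up to the (2l+1)/z of the recurrence. *)
Lemma rayleigh_rb f g :
  (forall z, is_Cderive f z (g z)) -> (forall z, is_Cderive g z (- f z)%C) ->
  forall l (z : C), z <> 0 ->
  rayleigh l (fun w => (f w / w)%C) z = (rb f g l z / z ^ S l)%C.
Proof.
  intros Hf Hg l. induction l as [|l IH]; intros z Hz.
  - unfold rayleigh, rb; simpl. field. auto.
  - change (rayleigh (S l) (fun w => (f w / w)%C) z)
      with (- (C_derive (rayleigh l (fun w => (f w / w)%C)) z / z))%C.
    rewrite (C_derive_eq _ _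
      ((rb_prev f g l z - RtoC (INR l) / z * rb f g l z) * / z ^ S l
       + rb f g l z * ((RtoC (INR (S l)) * z ^ l) * - / (z ^ S l * z ^ S l)))%C).
    + rewrite rb_S, S_INR, !RtoC_plus, !RtoC_mult. simpl Cpow.
      field. split; auto using Cpow_nz.
    (* The induction hypothesis holds off the origin only, which suffices because a derivative at z
       <> 0 is local. *)
    + apply is_Cderive_ext_nonzero with (f := fun w => (rb f g l w * / w ^ S l)%C);
        [auto | intros w Hw; symmetry; now apply IH |].
      apply (is_Cderive_mult (rb f g l) (fun w => / w ^ S l)%C);
        [now apply is_Cderive_rb|].
      apply (is_Cderive_comp Cinv (fun w => (w ^ S l)%C));
        [apply (is_Cderive_inv (z ^ S l)), Cpow_nz, Hz | apply is_Cderive_pow].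
Qed.

Lemma is_Cderive_opp_Csin z : is_Cderive (fun w => - Csin w)%C z (- Ccos z)%C.
Proof.
  apply (is_Cderive_ext (fun w => (- (1) * Csin w)%C)); [intros w; ring|].
  eapply is_Cderive_eq; [apply is_Cderive_scal, is_Cderive_Csin | ring].
Qed.

(** * Recurrences and derivatives of psi and xi *)

Lemma psi_rb l (z : C) : z <> 0 -> psi l z = rb Csin Ccos l z.
Proof.
  intros Hz. unfold psi, sph_j.
  rewrite (rayleigh_rb Csin Ccos is_Cderive_Csin is_Cderive_Ccos) by auto.
  simpl Cpow. field. split; auto using Cpow_nz.
Qed.

Lemma xi_rb l (z : C) : z <> 0 ->
  xi l z = (rb Csin Ccos l z + - Ci * rb Ccos (fun w => - Csin w)%C l z)%C.
Proof.
  intros Hz. unfold xi, sph_h1, sph_j, sph_y.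
  rewrite (rayleigh_rb Csin Ccos is_Cderive_Csin is_Cderive_Ccos) by auto.
  rewrite (rayleigh_rb Ccos (fun w => - Csin w)%C is_Cderive_Ccos is_Cderive_opp_Csin)
    by auto.
  simpl Cpow. field. split; auto using Cpow_nz.
Qed.

(** This is psi_{l-1}, extended to l = 0 by psi_{-1} = cos without truncated subtraction; likewise
    xi_{-1}(z) = e^{iz} below. *)
Definition psi_prev (l : nat) (z : C) : C := rb_prev Csin Ccos l z.
Definition xi_prev (l : nat) (z : C) : C :=
  (psi_prev l z + - Ci * rb_prev Ccos (fun w => - Csin w)%C l z)%C.

Lemma psi'_eq l (z : C) : z <> 0 ->
  psi' l z = (psi_prev l z - RtoC (INR l) / z * psi l z)%C.
Proof.
  intros Hz. apply C_derive_eq.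
  apply is_Cderive_ext_nonzero with (f := rb Csin Ccos l);
    [auto | intros w Hw; symmetry; now apply psi_rb |].
  rewrite psi_rb by auto.
  exact (proj1 (is_Cderive_rb _ _ is_Cderive_Csin is_Cderive_Ccos l z Hz)).
Qed.

Lemma xi'_eq l (z : C) : z <> 0 ->
  xi' l z = (xi_prev l z - RtoC (INR l) / z * xi l z)%C.
Proof.
  intros Hz. apply C_derive_eq.
  apply is_Cderive_ext_nonzero with
    (f := fun w => (rb Csin Ccos l w + - Ci * rb Ccos (fun w => - Csin w)%C l w)%C);
    [auto | intros w Hw; symmetry; now apply xi_rb |].
  rewrite xi_rb by auto. unfold xi_prev, psi_prev. eapply is_Cderive_eq.
  - apply is_Cderive_plus; [|apply is_Cderive_scal].
    + exact (proj1 (is_Cderive_rb _ _ is_Cderive_Csin is_Cderive_Ccos l z Hz)).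
    + exact (proj1 (is_Cderive_rb _ _ is_Cderive_Ccos is_Cderive_opp_Csin l z Hz)).
  - cbv beta. field. auto.
Qed.

Lemma psi_0 (z : C) : z <> 0 -> psi 0 z = Csin z.
Proof. intros Hz. now rewrite psi_rb. Qed.

Lemma psi_prev_0 z : psi_prev 0 z = Ccos z.
Proof. reflexivity. Qed.

Lemma psi_S l (z : C) : z <> 0 ->
  psi (S l) z = (RtoC (2 * INR l + 1) / z * psi l z - psi_prev l z)%C.
Proof. intros Hz. rewrite !psi_rb, rb_S by auto. unfold psi_prev. field. auto. Qed.

Lemma psi_prev_S l (z : C) : z <> 0 -> psi_prev (S l) z = psi l z.
Proof. intros Hz. now rewrite psi_rb. Qed.

Lemma xi_0 (z : C) : z <> 0 -> xi 0 z = (- Ci * Cexp (Ci * z))%C.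
Proof.
  intros Hz. rewrite xi_rb by auto. unfold rb; simpl.
  rewrite Csin_exp, Ccos_exp.
  replace (/ (2 * Ci))%C with (/ 2 * - Ci)%C by (apply C_eq; simpl; field).
  field.
Qed.

Lemma xi_prev_0 z : xi_prev 0 z = Cexp (Ci * z).
Proof.
  unfold xi_prev, psi_prev, rb_prev; simpl. rewrite Csin_exp, Ccos_exp.
  replace (/ (2 * Ci))%C with (/ 2 * - Ci)%C by (apply C_eq; simpl; field).
  replace (- Ci * - (/ 2 * - Ci * (Cexp (Ci * z) + - (1) * Cexp (- Ci * z))))%C
    with (- (Ci * Ci) * / 2 * (Cexp (Ci * z) + - (1) * Cexp (- Ci * z)))%C by ring.
  rewrite Ci_sqr. field.
Qed.

Lemma xi_S l (z : C) : z <> 0 ->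
  xi (S l) z = (RtoC (2 * INR l + 1) / z * xi l z - xi_prev l z)%C.
Proof. intros Hz. rewrite !xi_rb, !rb_S by auto. unfold xi_prev, psi_prev. field. auto. Qed.

Lemma xi_prev_S l (z : C) : z <> 0 -> xi_prev (S l) z = xi l z.
Proof. intros Hz. now rewrite xi_rb. Qed.

(** * Hermitian form and quadratic optimization *)

(** [A], [B], [D] form the Gram matrix of (u, u') and (v, v') for a Hermitian form with zero
    diagonal and determinant -|alpha|^2 / 4. Changing vectors multiplies that determinant by the
    squared modulus of the Wronskian. *)
Lemma hermitian_det (alpha u u' v v' : C) :
  let A := - Im (alpha * u' * Cconj u)%C in
  let B := (1 / (2 * Ci) * (- (alpha * u' * Cconj v) + Cconj alpha * Cconj v' * u))%C in
  let D := - Im (alpha * v' * Cconj v)%C in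
  Cmod B ^ 2 - A * D = Cmod alpha ^ 2 * Cmod (v * u' - v' * u)%C ^ 2 / 4.
Proof.
  intros A B D.
  replace B with (RtoC (/ 2) * (Ci * (alpha * u' * Cconj v - Cconj alpha * Cconj v' * u)))%C.
  2: { unfold B. replace (1 / (2 * Ci))%C with (RtoC (/ 2) * - Ci)%C; [ring|].
       apply C_eq; simpl; field. }
  rewrite !Cmod2_alt. unfold A, D. destruct alpha, u, u', v, v'. simpl. field.
Qed.

(** beta B is the larger root of the concave quadratic a m^2 + 2 B m + c, which is negative beyond
    it. *)
Lemma quadratic_optimum (a c B : R) :
  a < 0 -> 0 < B -> 0 <= B ^ 2 - a * c ->
  let beta := - (1 / a) + sqrt (1 / a ^ 2 - c / (a * B ^ 2)) in
  0 < beta /\ a * (beta * B) ^ 2 + 2 * (beta * B ^ 2) + c = 0 /\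
  forall m : R, 0 <= a * m ^ 2 + 2 * (B * m) + c -> m <= beta * B.
Proof.
  intros Ha HB Hd beta.
  set (s := sqrt (1 / a ^ 2 - c / (a * B ^ 2))) in *.
  assert (Hs : 0 <= s) by apply sqrt_pos.
  assert (Hs2 : s ^ 2 = (B ^ 2 - a * c) / (a ^ 2 * B ^ 2)).
  { unfold s. rewrite pow2_sqrt.
    - field. lra.
    - replace (1 / a ^ 2 - c / (a * B ^ 2)) with ((B ^ 2 - a * c) / (a ^ 2 * B ^ 2))
        by (field; lra).
      apply Rmult_le_pos; [exact Hd|]. apply Rlt_le, Rinv_0_lt_compat.
      apply Rmult_lt_0_compat; nra. }
  (* Completing the square: a beta + 1 = a s, and [Hs2] gives the square of s. *)
  assert (Hab : a * beta = a * s - 1) by (unfold beta; field; lra).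
  assert (Hb : 0 < beta).
  { assert (a * s <= 0) by nra. nra. }
  assert (Hz : a * (beta * B) ^ 2 + 2 * (beta * B ^ 2) + c = 0).
  { apply Rmult_eq_reg_l with a; [|lra].
    replace (a * (a * (beta * B) ^ 2 + 2 * (beta * B ^ 2) + c))
      with (B ^ 2 * ((a * beta + 1) ^ 2 - 1) + a * c) by ring.
    rewrite Hab. replace (a * s - 1 + 1) with (a * s) by ring.
    rewrite Rpow_mult_distr, Hs2. field. lra. }
  repeat split; auto.
  intros n Hn. destruct (Rle_or_lt n (beta * B)) as [|Hlt]; [assumption|exfalso].
  (* The root lies at or beyond the vertex -B / a. The product asserted negative below is the
     quadratic at n minus its value 0 at the root. *)
  assert (a * (beta * B) <= - B) by (assert (a * s <= 0) by nra; nra).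
  assert (a * n < - B) by nra.
  assert ((n - beta * B) * (a * (n + beta * B) + 2 * B) < 0) by nra.
  nra.
Qed.

(** * Flux step, Wronskian and real arguments *)

(** Used with p = k, x = xi_l, y = xi_{l-1}. The r-term contributes r |p|^2 |x|^2, which is real, to
    the first product, and r |x|^2 Im (p^2) >= 0 to the second imaginary part. *)
Lemma flux_step (p x y : C) (r : R) : 0 <= r -> 0 <= Re p -> 0 <= Im p ->
  let x1 := (RtoC r * Cconj p * x - y)%C in
  Im (Cconj p * x * Cconj x1)%C = Im (p * y * Cconj x)%C /\
  Im (Cconj p * y * Cconj x)%C <= Im (p * x * Cconj x1)%C.
Proof.
  intros Hr H1 H2. destruct p as [p q], x as [x1 x2], y as [y1 y2]. simpl in *. split.
  - ring.
  - assert (0 <= 2 * r * (p * q) * (x1 ^ 2 + x2 ^ 2)).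
    { apply Rmult_le_pos; [|nra]. apply Rmult_le_pos; nra. }
    nra.
Qed.

(** The l/z terms of the derivatives cancel, and the recurrence leaves the remaining cross product
    independent of l; at l = 0 it is i e^{iz} e^{-iz}. *)
Lemma wronskian_psi_xi l (z : C) : z <> 0 ->
  (psi l z * xi' l z - psi' l z * xi l z)%C = Ci.
Proof.
  intros Hz. rewrite psi'_eq, xi'_eq by auto.
  transitivity (psi l z * xi_prev l z - psi_prev l z * xi l z)%C; [ring|].
  induction l as [|l IH].
  - rewrite psi_0, xi_0, psi_prev_0, xi_prev_0, Csin_exp, Ccos_exp by auto.
    replace (/ (2 * Ci))%C with (/ 2 * - Ci)%C by (apply C_eq; simpl; field).
    assert (E : (Cexp (Ci * z) * Cexp (- Ci * z) = 1)%C).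
    { rewrite <- Cexp_plus. replace (Ci * z + - Ci * z)%C with (RtoC 0) by ring.
      apply C_eq; simpl; rewrite exp_0, ?cos_0, ?sin_0; ring. }
    transitivity (Ci * (Cexp (Ci * z) * Cexp (- Ci * z)))%C; [field | rewrite E; ring].
  - rewrite psi_S, xi_S, psi_prev_S, xi_prev_S by auto. rewrite <- IH. ring.
Qed.

Lemma Cexp_Ci_R (x : R) : Cexp (Ci * x) = (cos x, sin x).
Proof.
  unfold Cexp. replace (Ci * x)%C with (0, x) by (apply C_eq; simpl; ring).
  simpl. rewrite exp_0. f_equal; ring.
Qed.

Lemma Csin_R (x : R) : Csin x = RtoC (sin x).
Proof.
  unfold Csin. replace (- (Ci * x))%C with (Ci * RtoC (- x))%C by (apply C_eq; simpl; ring).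
  rewrite !Cexp_Ci_R, cos_neg, sin_neg. apply C_eq; simpl; field.
Qed.

Lemma Ccos_R (x : R) : Ccos x = RtoC (cos x).
Proof.
  unfold Ccos. replace (- (Ci * x))%C with (Ci * RtoC (- x))%C by (apply C_eq; simpl; ring).
  rewrite !Cexp_Ci_R, cos_neg, sin_neg. apply C_eq; simpl; field.
Qed.

(** At l = 0 the values are sin x, cos x, -i e^{ix} and e^{ix}; the recurrence has real coefficients
    and preserves the relations. *)
Lemma psi_xi_real_arg l (x : R) : x <> 0 ->
  (Im (psi l x) = 0 /\ Im (psi_prev l x) = 0) /\
  (Re (xi l x) = Re (psi l x) /\ Re (xi_prev l x) = Re (psi_prev l x)).
Proof.
  intros Hx. assert (Hz : RtoC x <> 0) by (intros H; apply Hx, RtoC_inj, H).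
  induction l as [|l [[I1 I2] [R1 R2]]].
  - rewrite psi_0, xi_0, psi_prev_0, xi_prev_0, Csin_R, Ccos_R, Cexp_Ci_R by auto.
    simpl. repeat split; ring.
  - rewrite psi_S, xi_S, psi_prev_S, xi_prev_S by auto.
    rewrite <- RtoC_div by auto. unfold Cminus.
    rewrite !im_plus, !re_plus, !im_opp, !re_opp, im_scal_l, !re_scal_l, I1, I2, R1, R2.
    repeat split; ring.
Qed.

Lemma psi'_xi'_real_arg l (x : R) : x <> 0 ->
  Im (psi' l x) = 0 /\ Re (xi' l x) = Re (psi' l x).
Proof.
  intros Hx. assert (Hz : RtoC x <> 0) by (intros H; apply Hx, RtoC_inj, H).
  destruct (psi_xi_real_arg l x Hx) as [[I1 I2] [R1 R2]].
  rewrite psi'_eq, xi'_eq by auto. rewrite <- RtoC_div by auto. unfold Cminus.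
  rewrite !im_plus, !re_plus, !im_opp, !re_opp, im_scal_l, !re_scal_l, I1, I2, R1, R2.
  split; ring.
Qed.

(** * Positive fluxes and the sign of the coefficient [a2] *)

(** Brings the factor 1/z of the recurrence to the form required by [flux_step], a positive real
    times the conjugate of k. *)
Lemma Cinv_real_mult (k : C) (a : R) : 0 < Re k -> 0 < a ->
  (/ (k * a))%C = (RtoC (/ (a * Cmod k ^ 2)) * Cconj k)%C.
Proof.
  intros Hk Ha. rewrite Cmod2_alt. destruct k as [p q]. simpl in *.
  assert (0 < p * p + q * q) by nra. assert (0 < a * (p * p + q * q)) by nra.
  apply C_eq; simpl; field. all: repeat split; nra.
Qed.

Lemma Re_pos_mult_nz (k : C) (a : R) : 0 < Re k -> 0 < a -> (k * a)%C <> 0.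
Proof.
  intros Hk Ha H. apply (f_equal Re) in H. rewrite re_scal_r, re_RtoC in H. nra.
Qed.

Lemma xi_power_flux_pos l (a : R) (k : C) : 0 < a -> 0 < Re k -> 0 <= Im k ->
  0 < Im (Cconj k * xi_prev l (k * a) * Cconj (xi l (k * a)))%C /\
  0 < Im (k * xi_prev l (k * a) * Cconj (xi l (k * a)))%C.
Proof.
  intros Ha Hr Hi. pose proof (Re_pos_mult_nz k a Hr Ha) as Hz.
  assert (0 < Cmod k) by (apply Cmod_gt_0; intros ->; simpl in Hr; lra).
  induction l as [|l [IH1 IH2]].
  - rewrite xi_0, xi_prev_0 by auto. set (e := Cexp (Ci * (k * a))).
    (* At l = 0 both fluxes equal Re k |e|^2, so it remains that the exponential has no zero. *)
    assert (He : 0 < Re e ^ 2 + Im e ^ 2).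
    { rewrite <- Cmod2_alt. apply pow_lt, Cmod_gt_0. intros E.
      assert (E1 : (e * Cexp (- (Ci * (k * a))) = 1)%C).
      { unfold e. rewrite <- Cexp_plus.
        replace (Ci * (k * a) + - (Ci * (k * a)))%C with (RtoC 0) by ring.
        apply C_eq; simpl; rewrite exp_0, ?cos_0, ?sin_0; ring. }
      rewrite E, Cmult_0_l in E1. apply RtoC_inj in E1. lra. }
    clearbody e. destruct k as [p q], e as [u v]. simpl in *.
    assert (0 < p * (u * (u * 1) + v * (v * 1))) by (apply Rmult_lt_0_compat; lra).
    split; ring_simplify; ring_simplify in H0; lra.
  - rewrite xi_S, xi_prev_S by auto.
    replace (RtoC (2 * INR l + 1) / (k * a))%C
      with (RtoC ((2 * INR l + 1) * / (a * Cmod k ^ 2)) * Cconj k)%C.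
    2: { unfold Cdiv. rewrite Cinv_real_mult, (RtoC_mult (2 * INR l + 1)) by auto. ring. }
    destruct (flux_step k (xi l (k * a)) (xi_prev l (k * a))
      ((2 * INR l + 1) * / (a * Cmod k ^ 2))) as [E1 E2]; [|lra|lra|].
    + apply Rmult_le_pos; [generalize (pos_INR l); lra|].
      apply Rlt_le, Rinv_0_lt_compat, Rmult_lt_0_compat; [|apply pow_lt]; lra.
    + split; [rewrite E1; exact IH2 | lra].
Qed.

Lemma a2_lt_0 l (a : R) (k : C) : 0 < a -> 0 < Re k -> 0 <= Im k -> a2 l a k < 0.
Proof.
  intros Ha Hr Hi. destruct (xi_power_flux_pos l a k Ha Hr Hi) as [H _].
  unfold a2. rewrite xi'_eq by (now apply Re_pos_mult_nz).
  unfold Cdiv at 2. rewrite Cinv_real_mult by auto.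
  set (s := / (a * Cmod k ^ 2)).
  assert (Hs : 0 <= INR l * s).
  { apply Rmult_le_pos; [apply pos_INR|]. apply Rlt_le, Rinv_0_lt_compat.
    apply Rmult_lt_0_compat; [lra|]. apply pow_lt, Cmod_gt_0.
    intros E. rewrite E in Hr. simpl in Hr. lra. }
  clearbody s. destruct (xi l (k * a)) as [x1 x2], (xi_prev l (k * a)) as [y1 y2].
  unfold Cdiv. rewrite <- RtoC_inv by lra.
  assert (Hp : 0 < / Re k) by (now apply Rinv_0_lt_compat).
  destruct k as [p q]. simpl in *. set (n := INR l) in *.
  assert (0 <= (n * s) * (p * q) * (x1 ^ 2 + x2 ^ 2)).
  { apply Rmult_le_pos; [|nra]. apply Rmult_le_pos; nra. }
  (* The first two products form the flux P_l; the last term comes from -(l/z) xi_l and is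
     non-negative because Im (k^2) is. *)
  match goal with |- - ?e < 0 =>
    replace e with (/ p * ((p * y1 - - q * y2) * - x2 + (p * y2 + - q * y1) * x1
      + 2 * ((n * s) * (p * q) * (x1 ^ 2 + x2 ^ 2)))) by ring end.
  apply Ropp_lt_gt_0_contravar, Rmult_lt_0_compat; lra.
Qed.

(** * Optimality in a passive background *)

Lemma b2_sqr_sub_a2_c2 l (a : R) (k : C) : 0 < Re k ->
  0 <= Cmod (b2 l a k) ^ 2 - a2 l a k * c2 l a k.
Proof.
  intros Hr. unfold a2, c2, b2.
  assert (E : (k / Re k)%C = Cconj (Cconj k / Re k)).
  { destruct k as [p q]. simpl in Hr. apply C_eq; simpl; field; nra. }
  rewrite E, hermitian_det. pose proof (pow2_ge_0 (Cmod (Cconj k / Re k)%C)).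
  match goal with |- 0 <= _ * ?e / 4 => assert (0 <= e) by apply pow2_ge_0 end.
  unfold Rdiv. apply Rmult_le_pos; [now apply Rmult_le_pos | lra].
Qed.

Lemma cross_section_prefactor_pos l (k : C) : 0 < Re k ->
  0 < 2 * PI * (2 * INR l + 1) / Cmod k ^ 2.
Proof.
  intros Hr. pose proof PI_RGT_0. pose proof (pos_INR l).
  apply Rdiv_lt_0_compat.
  - apply Rmult_lt_0_compat; lra.
  - apply pow_lt, Cmod_gt_0. intros E. rewrite E in Hr. simpl in Hr. lra.
Qed.

(** The phase of conj b makes Re (b t) = |b| |t|, so this t meets the constraint with equality,
    while every feasible s satisfies the quadratic inequality in |s|. *)
Lemma beta_conj_b2_optimal l (a : R) (k : C) :
  0 < a -> 0 < Re k -> 0 <= Im k -> b2 l a k <> 0 ->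
  is_optimal l a k (beta l a k * Cconj (b2 l a k))%C.
Proof.
  intros Ha Hr Hi Hb.
  pose proof (a2_lt_0 l a k Ha Hr Hi) as Ha2.
  pose proof (cross_section_prefactor_pos l k Hr) as HK.
  destruct (quadratic_optimum (a2 l a k) (c2 l a k) (Cmod (b2 l a k)) Ha2
    (proj1 (Cmod_gt_0 _) Hb) (b2_sqr_sub_a2_c2 l a k Hr)) as [H0 [H1 H2]].
  fold (beta l a k) in *.
  assert (Hmod : Cmod (beta l a k * Cconj (b2 l a k))%C = beta l a k * Cmod (b2 l a k)).
  { rewrite Cmod_mult, Cmod_conj, Cmod_R, Rabs_pos_eq; lra. }
  unfold is_optimal, Cabs, Cs. rewrite Hmod. split.
  - apply Rmult_le_pos; [lra|].
    replace (b2 l a k * (beta l a k * Cconj (b2 l a k)))%C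
      with (RtoC (beta l a k) * (b2 l a k * Cconj (b2 l a k)))%C by ring.
    rewrite <- Cmod2_conj, <- RtoC_mult, re_RtoC. lra.
  - intros s Hs.
    assert (Hq : 0 <= a2 l a k * Cmod s ^ 2 + 2 * Re (b2 l a k * s)%C + c2 l a k).
    { apply Rmult_le_reg_l with (1 := HK). lra. }
    assert (Hle : Cmod s <= beta l a k * Cmod (b2 l a k)).
    { apply H2. rewrite <- Cmod_mult. pose proof (re_le_Cmod (b2 l a k * s)%C).
      pose proof (Rle_abs (Re (b2 l a k * s)%C)). lra. }
    assert (Hp : Cmod s ^ 2 <= (beta l a k * Cmod (b2 l a k)) ^ 2).
    { apply pow_incr. split; [apply Cmod_ge_0 | exact Hle]. }
    rewrite <- !Ropp_mult_distr_l. apply Ropp_le_contravar.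
    rewrite !Rmult_assoc. apply Rmult_le_compat_l; [lra|]. nra.
Qed.

(** * The lossless background *)

(** Here k^* / Re k = 1, psi and psi' are real, and xi, xi' have them as real parts. Hence a = -Im W
    and b = -W / (2i) with Wronskian W = i, and c is the imaginary part of a real number. *)
Lemma lossless_coefficients l (a k : R) : 0 < a -> 0 < k ->
  a2 l a k = -1 /\ b2 l a k = RtoC (-1 / 2) /\ c2 l a k = 0.
Proof.
  intros Ha Hk. unfold a2, b2, c2. rewrite re_RtoC, <- RtoC_mult.
  assert (Hx : k * a <> 0) by nra.
  destruct (psi_xi_real_arg l _ Hx) as [[I1 _] [R1 _]].
  destruct (psi'_xi'_real_arg l _ Hx) as [I2 R2].
  assert (Hz : RtoC (k * a) <> 0) by (intros H; apply Hx, RtoC_inj, H).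
  pose proof (wronskian_psi_xi l _ Hz) as HW.
  assert (E : (Cconj k / k)%C = 1).
  { replace (Cconj k) with (RtoC k) by (apply C_eq; simpl; ring).
    rewrite <- RtoC_div by lra. f_equal. field. lra. }
  assert (E' : (k / k)%C = 1) by (rewrite <- RtoC_div by lra; f_equal; field; lra).
  rewrite E, E'.
  destruct (psi l (RtoC (k * a))) as [p p2], (psi' l (RtoC (k * a))) as [p' p2'],
    (xi l (RtoC (k * a))) as [x x2], (xi' l (RtoC (k * a))) as [x' x2'].
  simpl in I1, I2, R1, R2. subst.
  pose proof (f_equal Im HW) as HW'. simpl in HW'. clear HW.
  repeat split.
  - simpl. lra.
  - apply C_eq; simpl; field_simplify; lra.
  - simpl. lra.
Qed.

(** The constraint describes the disc |s + 1/2| <= 1/2, whose only point farthest from the origin is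
    -1. *)
Lemma lossless_optimal_iff l (a k : R) (t : C) : 0 < a -> 0 < k ->
  is_optimal l a k t <-> t = RtoC (-1).
Proof.
  intros Ha Hk. destruct (lossless_coefficients l a k Ha Hk) as [Ea [Eb Ec]].
  pose proof (cross_section_prefactor_pos l k Hk) as HK.
  unfold is_optimal, Cabs, Cs. rewrite Ea, Eb, Ec.
  set (K := 2 * PI * (2 * INR l + 1) / Cmod k ^ 2) in *.
  assert (Hfeas : forall s : C,
    0 <= K * (-1 * Cmod s ^ 2 + 2 * Re (RtoC (-1 / 2) * s)%C + 0)
    <-> Cmod s ^ 2 <= - Re s).
  { intros s. rewrite re_scal_l. split; intros H.
    - apply Rmult_le_reg_l with (1 := HK). nra.
    - apply Rmult_le_pos; lra. }
  assert (H1 : Cmod (RtoC (-1)) = 1) by (rewrite Cmod_R, Rabs_left; lra).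
  split.
  - intros [H Ho]. apply Hfeas in H.
    (* Comparison with the feasible point -1 gives |t| >= 1; together with |t|^2 <= -Re t this
       forces t = -1. *)
    specialize (Ho (RtoC (-1))). rewrite Hfeas, H1, re_RtoC in Ho.
    specialize (Ho ltac:(lra)).
    assert (Hm : 1 <= Cmod t ^ 2) by (apply Rmult_le_reg_l with (1 := HK); nra).
    rewrite Cmod2_alt in *. destruct t as [u v]. simpl in *.
    assert (u = -1) by nra. subst. apply C_eq; simpl; nra.
  - intros ->. split.
    + apply Hfeas. rewrite H1, re_RtoC. lra.
    + intros s Hs. apply Hfeas in Hs. rewrite H1.
      assert (Cmod s ^ 2 <= 1); [|nra].
      rewrite Cmod2_alt in *. destruct s as [u v]. simpl in *. nra.
Qed.

(** * Background wavenumber and conclusion *)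

Lemma wavenumber_first_quadrant (k0 : R) (e : C) : 0 < k0 ->
  ~ (Im e = 0 /\ Re e <= 0) -> 0 <= Im e ->
  0 < Re (k0 * Csqrt e)%C /\ 0 <= Im (k0 * Csqrt e)%C.
Proof.
  intros Hk He Hi. rewrite re_scal_l, im_scal_l. unfold Csqrt. simpl.
  destruct (Rle_dec 0 (Im e)) as [_|]; [|contradiction]. split.
  - apply Rmult_lt_0_compat; [exact Hk|]. apply sqrt_lt_R0.
    pose proof (re_le_Cmod e). pose proof (Rle_abs (- Re e)) as H'. rewrite Rabs_Ropp in H'.
    (* The real part of the root vanishes only if |e| = -Re e, that is, on the excluded branch
       cut. *)
    assert (Cmod e + Re e <> 0); [|lra].
    intros E. apply He. pose proof (Cmod2_alt e) as H2. pose proof (Cmod_ge_0 e).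
    replace (Cmod e) with (- Re e) in H2 by lra.
    split; [nra | lra].
  - rewrite Rmult_1_l. apply Rmult_le_pos; [lra | apply sqrt_pos].
Qed.

Theorem mainTheorem2 (l : nat) (a k0 : R) (eps_b : C)
  (hl : (1 <= l)%nat) (ha : 0 < a) (hk0 : 0 < k0)
  (heps : ~ (Im eps_b = 0 /\ Re eps_b <= 0)) (hpassive : 0 <= Im eps_b) :
  let k_b := (k0 * Csqrt eps_b)%C in
  (b2 l a k_b <> 0 ->
     is_optimal l a k_b (beta l a k_b * Cconj (b2 l a k_b))%C /\
     Cs l a k_b (beta l a k_b * Cconj (b2 l a k_b))%C
       = 2 * PI * (2 * INR l + 1) / Cmod k_b ^ 2
         * (- a2 l a k_b) * Cmod (b2 l a k_b) ^ 2 * beta l a k_b ^ 2) /\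
  (Im k_b = 0 ->
     a2 l a k_b = -1 /\
     b2 l a k_b = RtoC (-1 / 2) /\
     c2 l a k_b = 0 /\
     (beta l a k_b * Cconj (b2 l a k_b))%C = RtoC (-1) /\
     (forall t : C, is_optimal l a k_b t <-> t = RtoC (-1)) /\
     RtoC (Cs l a k_b (RtoC (-1)))
       = (RtoC (2 * PI * (2 * INR l + 1)) / k_b ^ 2)%C).
Proof.
  intros k_b.
  destruct (wavenumber_first_quadrant k0 eps_b hk0 heps hpassive) as [Hr Hi].
  fold k_b in Hr, Hi. clearbody k_b. split.
  - intros Hb. split; [now apply beta_conj_b2_optimal|].
    unfold Cs. rewrite Cmod_mult, Cmod_conj, Cmod_R, Rpow_mult_distr, pow2_abs. ring.
  - intros H0. destruct k_b as [k q]. simpl in H0, Hr. subst q.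
    change (k, 0) with (RtoC k). destruct (lossless_coefficients l a k ha Hr) as [Ea [Eb Ec]].
    split; [exact Ea|]. split; [exact Eb|]. split; [exact Ec|]. split; [|split].
    + unfold beta. rewrite Ea, Eb, Ec.
      (* With a = -1 and c = 0 this gives beta = 1 + 1 = 2, hence beta conj b = -1. *)
      replace (1 / (-1) ^ 2 - 0 / (-1 * Cmod (RtoC (-1 / 2)) ^ 2)) with 1
        by (rewrite Cmod_R, pow2_abs; field).
      rewrite sqrt_1. apply C_eq; simpl; field.
    + intros t. now apply lossless_optimal_iff.
    + unfold Cs. rewrite Ea, !Cmod_R, !pow2_abs, <- RtoC_pow, <- RtoC_div.
      * f_equal. field. lra.
      * apply pow_nonzero. lra.
Qed.
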